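(* Let $Q_0\subset\mathbb{R}^n$ be a cube, $1/2<s<1$, and $f$ a measurable function on $Q_0$ that is equivalent to a bounded function on $Q_0$. Then $f$ is equivalent to a continuous function on $Q_0$ if and only if $\lim_{\eta\to0^+}\Omega(f,s,\eta)=0$.
   Context: Cubes have sides parallel to the coordinate axes; $|E|$ is Lebesgue measure. A measurable function $f$ on $Q_0$ is equivalent to a continuous (resp. bounded) function on $Q_0$ if its values can be modified on a set of Lebesgue measure $0$ so as to coincide with a continuous (resp. bounded) function on $Q_0$. For a cube $Q$, $0<s<1$ and a real-valued measurable $g$ on $Q$, the maximal median is $$m_g(s,Q)=\sup\{M\in\mathbb{R}: |\{y\in Q: g(y)<M\}|\le s|Q|\}.$$ For nonoverlapping cubes $Q_1,Q_2$ (disjoint interiors) let $$\Psi_s(g,Q_1,Q_2)=\frac{|Q_1|}{|Q_1\cup Q_2|}\,m_g(s,Q_1)+\frac{|Q_2|}{|Q_1\cup Q_2|}\,m_g(s,Q_2),$$ and for $\delta>0$ $$\Omega(f,s,\delta)=\sup_{\operatorname{diam}(Q_1\cup Q_2)\le\delta}\ \inf_{c}\ \Psi_s(|f-c|,Q_1,Q_2),$$ where the supremum is over pairs of nonoverlapping cubes $Q_1,Q_2\subset Q_0$ and the infimum over real constants $c$. *)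

(* Defs.v *)
From HB Require Import structures.
From mathcomp Require Import all_boot all_order all_algebra.
From mathcomp Require Import all_classical all_reals all_analysis.

Set Implicit Arguments.
Unset Strict Implicit.
Unset Printing Implicit Defensive.

Import Order.TTheory GRing.Theory Num.Theory.
Import numFieldNormedType.Exports.

Local Open Scope classical_set_scope.
Local Open Scope ring_scope.

(* The space R^d, d >= 1, is 'rV[R]_n.+1 with d = n.+1. MathComp-Analysis has
   no Lebesgue measure in several variables; it is built here as the
   restriction to the Caratheodory-measurable sets of the outer measure given
   by countable coverings by closed boxes. *)

Section lebesgue.
Variables (R : realType) (n : nat).
Local Notation V := 'rV[R]_n.+1.

(* A box is given by its two extreme vertices. *)
Definition is_box (B : V * V) : Prop := forall i, B.1 0 i <= B.2 0 i.

Definition box_set (B : V * V) : set V :=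
  [set x | forall i, B.1 0 i <= x 0 i <= B.2 0 i].

Definition box_vol (B : V * V) : R := \prod_i (B.2 0 i - B.1 0 i).

Definition box_cover (X : set V) : set (nat -> V * V) :=
  [set F | (forall k, is_box (F k)) /\ X `<=` \bigcup_k box_set (F k)].

Local Open Scope ereal_scope.

Definition lebesgue_outer (X : set V) : \bar R :=
  ereal_inf [set \sum_(k <oo) (box_vol (F k))%:E | F in box_cover X].

Let box_vol_ge0 B : is_box B -> 0 <= (box_vol B)%:E.
Proof.
by move=> Bb; rewrite lee_fin; apply: prodr_ge0 => i _; rewrite subr_ge0.
Qed.

Let lebesgue_outer_ge0 X : 0 <= lebesgue_outer X.
Proof.
apply: le_ereal_inf_tmp => _ [F [bF _] <-].
by apply: nneseries_ge0 => k _ _; exact: box_vol_ge0.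
Qed.

Let lebesgue_outer0 : lebesgue_outer set0 = 0.
Proof.
apply/eqP; rewrite eq_le lebesgue_outer_ge0 andbT.
apply: ereal_inf_lbound; exists (fun=> (0%R, 0%R)).
  by split=> [k i /=|]; [exact: lexx|exact: sub0set].
apply: eseries0 => k _ _.
by rewrite /box_vol /= big_ord_recl mxE subr0 mul0r.
Qed.

Let le_lebesgue_outer : {homo lebesgue_outer : A B / A `<=` B >-> A <= B}.
Proof.
move=> A B AB; apply/ereal_inf_le_tmp => x [F [bF BF] <-{x}].
by exists F => //; split => //; exact: subset_trans BF.
Qed.

Let lebesgue_outer_sigma_subadditive : sigma_subadditive lebesgue_outer.
Proof.
move=> A; have [[i ioo]|] := pselect (exists i, lebesgue_outer (A i) = +oo).
  rewrite (eseries_pinfty _ _ ioo) ?leey// => k _.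
  by rewrite -ltNye (lt_le_trans _ (lebesgue_outer_ge0 _)).
rewrite -forallNE => Aoo.
apply/lee_addgt0Pr => _/posnumP[e].
apply: (le_trans _ (epsilon_trick xpredT _ _)) => //.
pose P k (F : nat -> V * V) := box_cover (A k) F /\
  \sum_(j <oo) (box_vol (F j))%:E <=
  lebesgue_outer (A k) + (e%:num / (2 ^ k.+1)%:R)%:E.
have [G PG] : {G : nat -> nat -> V * V & forall k, P k (G k)}.
  apply: (@choice _ _ P) => k; rewrite /P /lebesgue_outer.
  set S := (X in ereal_inf X); move infS : (ereal_inf S) => iS.
  case: iS infS => [r Sr|Soo|Soo].
  - have en1 : (0 < e%:num / (2 ^ k.+1)%:R)%R by [].
    have /(lb_ereal_inf_adherent en1) : ereal_inf S \is a fin_num by rewrite Sr.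
    move=> [x [F cF Fx] xS].
    by exists F; split => //; rewrite Fx -Sr; exact/ltW.
  - by have := Aoo k; rewrite /lebesgue_outer Soo.
  - by have := lebesgue_outer_ge0 (A k); rewrite /lebesgue_outer Soo.
pose v (p : nat * nat) := (box_vol (G p.1 p.2))%:E.
have v0 p : 0 <= v p by apply: box_vol_ge0; exact: (PG p.1).1.1.
apply: (@le_trans _ _ (\esum_(p in setT) v p)).
  apply: ereal_inf_lbound => /=.
  have /card_esym/ppcard_eqP[f] := card_nat2.
  exists (fun k => G (f k).1 (f k).2).
    split=> [k|t [i _ /((PG i).1.2) [j _ Gt]]]; first exact: (PG (f k).1).1.1.
    by exists (f^-1%FUN (i, j)) => //=; rewrite invK ?inE.
  rewrite -(esum_pred_image v f xpredT) ?[fun=> _]set_true//.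
  by rewrite image_eq.
have -> : \esum_(p in setT) v p = \sum_(i <oo) \sum_(j <oo) v (i, j).
  pose J : nat -> set (nat * nat) := fun i => [set (i, j) | j in setT].
  have -> : setT = \bigcup_k J k.
    by rewrite predeqE => -[a b]; split => // _; exists a => //; exists b.
  have tJ : trivIset setT J.
    apply/trivIsetP => i j _ _ ij.
    rewrite predeqE => -[k m] /=; split => //= -[] [_] _ [<-{k} _].
    by move=> [m' _] [] /esym/eqP; rewrite (negbTE ij).
  rewrite esum_bigcupT//.
  rewrite -(image_id [set: nat]) -fun_true esum_pred_image//.
  apply: eq_eseriesr => /= j _.
  have pj : set_inj (fun k => predT k) (pair j : nat -> nat * nat).
    by move=> ? ? _ _; exact: (@can_inj _ _ _ snd).
  rewrite -(esum_pred_image v (pair j) predT)//=.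
    by congr esum; rewrite predeqE => -[a b]; split; move=> [i _ <-]; exists i.
  by move=> k _; exact: esum_ge0.
apply: lee_nneseries => k *; last exact: (PG k).2.
by apply: nneseries_ge0 => m *; exact: v0.
Qed.

HB.instance Definition _ := isOuterMeasure.Build R V lebesgue_outer
  lebesgue_outer0 lebesgue_outer_ge0 le_lebesgue_outer
  lebesgue_outer_sigma_subadditive.

End lebesgue.

(* R^(n.+1) with its sigma-algebra of Lebesgue-measurable sets *)
Notation Leb R n := (caratheodory_type (@lebesgue_outer R n)).

Notation lebesgue_mx R n := (@lebesgue_outer R n : set (Leb R n) -> \bar R).

Section medians.
Variables (R : realType) (n : nat).
Local Notation V := 'rV[R]_n.+1.
Local Notation mu := (lebesgue_mx R n).

(* Closed and nondegenerate. Closedness matters for the ambient cube: a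
   bounded continuous function on an open cube need not have vanishing
   oscillation. *)
Definition is_cube (Q : set V) : Prop :=
  exists (a : V) (h : R),
    0 < h /\ Q = [set x | forall i, a 0 i <= x 0 i <= a 0 i + h].

Definition nonoverlapping (Q1 Q2 : set V) : Prop := Q1^° `&` Q2^° = set0.

Definition euclidean_dist (x y : V) : R :=
  Num.sqrt (\sum_i (x 0 i - y 0 i) ^+ 2).

(* Only used for nonempty bounded sets, on which the real supremum is the
   intended one. *)
Definition diam (A : set V) : R :=
  sup [set euclidean_dist x y | x in A & y in A].

Definition volume (A : set V) : R := fine (mu A).

(* For measurable g, a cube Q and 0 < s < 1, the set of M's is nonempty and
   bounded above. *)
Definition max_median (g : V -> R) (s : R) (Q : set V) : R :=
  sup [set M | (mu (Q `&` [set y | (g y < M)%R]) <= s%:E * mu Q)%E].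

Definition Psi (s : R) (g : V -> R) (Q1 Q2 : set V) : R :=
  volume Q1 / volume (Q1 `|` Q2) * max_median g s Q1 +
  volume Q2 / volume (Q1 `|` Q2) * max_median g s Q2.

Definition admissible (Q0 : set V) (delta : R) (P : set V * set V) : Prop :=
  [/\ is_cube P.1 /\ is_cube P.2, P.1 `<=` Q0 /\ P.2 `<=` Q0,
      nonoverlapping P.1 P.2 & diam (P.1 `|` P.2) <= delta].

Definition Omega (Q0 : set V) (f : V -> R) (s delta : R) : \bar R :=
  ereal_sup [set ereal_inf
                   [set (Psi s (fun x => `|f x - c|) P.1 P.2)%:E | c in [set: R]]
            | P in admissible Q0 delta].

Definition equiv_continuous (Q : set V) (f : V -> R) : Prop :=
  exists g : V -> R, {within Q, continuous g} /\ (f = g %[ae mu in Q]).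

Definition equiv_bounded (Q : set V) (f : V -> R) : Prop :=
  exists g : V -> R, [bounded g x | x in Q] /\ (f = g %[ae mu in Q]).

End medians.

(* Main.v *)
(* If f agrees a.e. with a continuous g, take c to be a value of g and use the
   uniform continuity of g on Q_0.

   Conversely, let Omega(f, s, eta) < e. Two distinct cells T, T' of the same
   regular subdivision of Q_0, lying in a common set of diameter at most eta,
   have weights at least 1/2, hence some c satisfies |f - c| < 2e on more than a
   proportion s of T, and of T'. As s > 1/2, two such constants for the same
   cell are 4e-close, so one constant c_N serves, up to 6e, all the cells of the
   N-th subdivision near a given point. As f is essentially bounded, (c_N) has a
   cluster point c, so that for arbitrarily fine subdivisions {|f - c| >= 7e}
   fills at most a proportion 1 - s < 1 of each cell near the point. Such a set
   is null. Thus the essential oscillation of f is uniformly small at small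
   scales, and the essential upper limit of f is the continuous
   representative. *)
Require Import Defs.
From mathcomp Require Import all_boot all_order all_algebra.
From mathcomp Require Import all_classical all_reals all_analysis.
From mathcomp Require Import ring lra.

Import Order.TTheory GRing.Theory Num.Theory.
Import numFieldNormedType.Exports.

Local Open Scope classical_set_scope.
Local Open Scope ring_scope.

Set Implicit Arguments.
Unset Strict Implicit.
Unset Printing Implicit Defensive.

(** * Translation invariance of the outer measure and measurability of boxes *)

Section lebesgue_outer_theory.
Variables (R : realType) (n : nat).
Local Notation V := 'rV[R]_n.+1.
Implicit Types (B : V * V) (X : set V).

Lemma box_vol_ge0 B : is_box B -> 0 <= box_vol B.
Proof. by move=> bB; apply: prodr_ge0 => i _; rewrite subr_ge0. Qed.

Lemma lebesgue_outer_box B : is_box B ->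
  (lebesgue_outer (box_set B) <= (box_vol B)%:E)%E.
Proof.
move=> bB; pose F k : V * V := if k is 0%N then B else (0, 0).
apply: ereal_inf_lbound; exists F.
  split=> [[|k] i|x Bx]; [exact: bB|exact: lexx|].
  by exists 0%N => //; exact: Bx.
have Fge0 k : (0 <= (box_vol (F k))%:E)%E.
  by rewrite lee_fin; case: k => [|k]; apply: box_vol_ge0 => // i; exact: lexx.
rewrite nneseries_recl // eseries_cond eseries0 ?adde0// => -[//|k] _ _.
by rewrite /box_vol /= big_ord_recl mxE subr0 mul0r.
Qed.

Lemma le_lebesgue_outer_shift (v : V) X :
  (lebesgue_outer [set x : V | X (x + v)%R] <= lebesgue_outer X)%E.
Proof.
apply: le_ereal_inf_tmp => _ [F [bF XF] <-]; apply: ereal_inf_lbound.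
exists (fun k => ((F k).1 - v, (F k).2 - v)); last first.
  apply: eq_eseriesr => k _; congr EFin; apply: eq_bigr => i _ /=.
  by rewrite !mxE opprB addrA subrK.
split=> [k i|x /= /XF [k _ Fk]]; first by rewrite !mxE lerD2r; exact: bF.
by exists k => // i; have := Fk i; rewrite /= !mxE lerBlDr lerBrDr.
Qed.

Lemma lebesgue_outer_shift (v : V) X :
  lebesgue_outer [set x : V | X (x + v)] = lebesgue_outer X.
Proof.
apply/eqP; rewrite eq_le le_lebesgue_outer_shift /=.
have := le_lebesgue_outer_shift (- v) [set x : V | X (x + v)].
by congr (lebesgue_outer _ <= _)%E; apply/seteqP; split => x /=;
  rewrite subrK.
Qed.

(* The hyperplane may be on either side, so that this applies to both
   half-spaces and their complements. *)
Lemma measurable_halfspace (i : 'I_n.+1) (t : R) (H : set V) :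
  [set x : V | x 0 i < t] `<=` H -> H `<=` [set x | x 0 i <= t] ->
  measurable (H : set (Leb R n)).
Proof.
move=> ltH leH; apply: le_caratheodory_measurable => X /=.
apply: le_ereal_inf_tmp => _ [F [bF XF] <-].
(* The hyperplane cuts each covering box in two. If the box lies on one side, min and max make the
   other piece degenerate, of volume 0. *)
pose lo k : V * V := (
  \row_j (if j == i then Num.min ((F k).1 0 j) t else (F k).1 0 j),
  \row_j (if j == i then Num.min ((F k).2 0 j) t else (F k).2 0 j)).
pose hi k : V * V := (
  \row_j (if j == i then Num.max ((F k).1 0 j) t else (F k).1 0 j),
  \row_j (if j == i then Num.max ((F k).2 0 j) t else (F k).2 0 j)).
have blo k : is_box (lo k).
  move=> j; rewrite !mxE; case: ifP => _; last exact: bF.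
  by rewrite le_min !ge_min lexx bF orbT.
have bhi k : is_box (hi k).
  move=> j; rewrite !mxE; case: ifP => _; last exact: bF.
  by rewrite ge_max !le_max lexx bF orbT.
have volE k : (box_vol (F k) = box_vol (lo k) + box_vol (hi k))%R.
  have volD1 C : box_vol C =
      ((C.2 0 i - C.1 0 i) * \prod_(j | j != i) (C.2 0 j - C.1 0 j))%R.
    by rewrite /box_vol (bigD1 i).
  rewrite !volD1 /= !mxE eqxx.
  rewrite (eq_bigr (fun j => (F k).2 0 j - (F k).1 0 j)%R) => [|//].
  rewrite [X in (_ = _ * X + _)%R](eq_bigr (fun j => (F k).2 0 j - (F k).1 0 j)%R);
    last by move=> j /negbTE ji; rewrite !mxE ji.
  rewrite [X in (_ = _ + _ * X)%R](eq_bigr (fun j => (F k).2 0 j - (F k).1 0 j)%R);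
    last by move=> j /negbTE ji; rewrite !mxE ji.
  rewrite -mulrDl; congr (_ * _)%R.
  have := addr_max_min ((F k).1 0 i) t; have := addr_max_min ((F k).2 0 i) t.
  lra.
under eq_eseriesr do rewrite volE EFinD.
rewrite nneseriesD; [|by move=> k *; rewrite lee_fin; exact: box_vol_ge0..].
apply: leeD; apply: ereal_inf_lbound.
- exists lo => //; split => // x [/XF[k _ Fk] /leH /= xt]; exists k => // j.
  have /andP[? ?] := Fk j; rewrite !mxE.
  case: eqP => [->|]; last by move=> _; apply/andP.
  by have /andP[lx xh] := Fk i; rewrite ge_min le_min lx xh xt.
- exists hi => //; split => // x [/XF[k _ Fk] xH]; exists k => // j.
  have tx : t <= x 0 i by rewrite leNgt; apply: contra_notN xH => /ltH.
  have /andP[? ?] := Fk j; rewrite !mxE.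
  case: eqP => [->|]; last by move=> _; apply/andP.
  by have /andP[lx xh] := Fk i; rewrite ge_max le_max lx xh tx.
Qed.

Lemma measurable_box B : measurable (box_set B : set (Leb R n)).
Proof.
have -> : box_set B = \bigcap_(i in [set: 'I_n.+1])
    (~` [set x : V | x 0 i < B.1 0 i] `&` [set x : V | x 0 i <= B.2 0 i]).
  apply/seteqP; split => [x Bx i _|x Bx i].
    by have /andP[? ?] := Bx i; split=> //=; apply/negP; rewrite -leNgt.
  by have [/= /negP] := Bx i I; rewrite -leNgt => -> ->.
apply: (@fin_bigcap_measurable _ (Leb R n)) => // i _.
apply: measurableI; first apply: measurableC.
  by apply: (@measurable_halfspace i (B.1 0 i)) => // x /= /ltW.
by apply: (@measurable_halfspace i (B.2 0 i)) => // x /= /ltW.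
Qed.

End lebesgue_outer_theory.

(** * Cubes and their regular subdivisions *)

Section grid.
Variables (R : realType) (n : nat).
Local Notation V := 'rV[R]_n.+1.
Implicit Types (a b : V) (h t : R) (B : V * V).

Lemma le_outer_measure_bigsetU (T : Type) (m : {outer_measure set T -> \bar R})
    (I : finType) (P : pred I) (F : I -> set T) (X : set T) :
  (forall x, X x -> exists2 k, P k & F k x) ->
  (m X <= \sum_(k | P k) m (F k))%E.
Proof.
move=> XF; apply: (@le_trans _ _ (m (\big[setU/set0]_(k | P k) F k))).
  apply: le_outer_measure => x /XF[k Pk Fx].
  by rewrite -bigcup_seq_cond; exists k; rewrite //= mem_index_enum.
elim/big_rec2: _ => [|k s X' _ ih]; first by rewrite outer_measure0.
by apply: (le_trans (outer_measureU2 _ _ _)); rewrite leeD2l.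
Qed.

Definition cube a h : set V := [set x | forall i, a 0 i <= x 0 i <= a 0 i + h].

Lemma cubeE a h : cube a h = box_set (a, a + const_mx h).
Proof. by apply/seteqP; split => x ax i; have := ax i; rewrite /= !mxE. Qed.

Lemma measurable_cube a h : measurable (cube a h : set (Leb R n)).
Proof. by rewrite cubeE; exact: measurable_box. Qed.

Lemma lebesgue_outer_cube_le a h : 0 <= h ->
  (lebesgue_outer (cube a h) <= (h ^+ n.+1)%:E)%E.
Proof.
move=> h0; rewrite cubeE (le_trans (lebesgue_outer_box _)) //.
  by move=> i; rewrite /= !mxE lerDl.
rewrite lee_fin /box_vol /= (eq_bigr (fun=> h)) => [|i _].
  by rewrite prodr_const card_ord.
by rewrite !mxE addrAC subrr add0r.
Qed.

Lemma lebesgue_outer_cube_translate a b h :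
  lebesgue_outer (cube a h) = lebesgue_outer (cube b h).
Proof.
rewrite -(lebesgue_outer_shift (b - a) (cube b h)); congr lebesgue_outer.
by apply/seteqP; split => x ax i; have := ax i; rewrite /= !mxE; lra.
Qed.

Lemma lebesgue_outer_fin_num a h (X : set V) : 0 <= h -> X `<=` cube a h ->
  lebesgue_outer X \is a fin_num.
Proof.
move=> h0 Xa; rewrite ge0_fin_numE ?outer_measure_ge0//.
apply: (@le_lt_trans _ _ (h ^+ n.+1)%:E); last exact: ltry.
exact: le_trans (le_outer_measure _ _ _ Xa) (lebesgue_outer_cube_le _ h0).
Qed.

(* Cells of side [h / N.+1]: the index [N] stands for [N.+1] parts per side. *)
Definition cell a h N (k : {ffun 'I_n.+1 -> 'I_N.+1}) : set V :=
  cube (\row_i (a 0 i + (k i)%:R * (h / N.+1%:R))) (h / N.+1%:R).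

Lemma cell_subset a h N k : 0 < h -> @cell a h N k `<=` cube a h.
Proof.
move=> h0 x kx i; have := kx i; rewrite !mxE.
set t := h / _; have tE : h = N.+1%:R * t by rewrite /t mulrC divfK// pnatr_eq0.
have t0 : 0 < t by rewrite divr_gt0.
have : (k i)%:R + 1 <= N.+1%:R :> R by rewrite natr1 ler_nat ltn_ord.
have : 0 <= (k i)%:R :> R by [].
rewrite tE; nra.
Qed.

Lemma cell_cover a h N (x : V) : 0 < h -> cube a h x -> exists k, @cell a h N k x.
Proof.
move=> h0 ax; pose t := h / N.+1%:R.
have tE : h = N.+1%:R * t by rewrite /t mulrC divfK// pnatr_eq0.
have t0 : 0 < t by rewrite divr_gt0.
have key i : exists j : 'I_N.+1,
    a 0 i + j%:R * t <= x 0 i <= a 0 i + j%:R * t + t.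
  have /andP[ax1 ax2] := ax i.
  have y0 : 0 <= (x 0 i - a 0 i) / t by rewrite divr_ge0 ?subr_ge0// ltW.
  have /andP[jy yj] := Num.Theory.truncn_itv y0.
  move: jy yj; rewrite ler_pdivlMr// ltr_pdivrMr//.
  set j := Num.truncn _ => jy yj.
  have [jN|Nj] := ltnP j N.+1.
    by exists (Ordinal jN) => /=; move: jy yj; rewrite -natr1; nra.
  (* Here [x] lies on the upper face in direction [i], where truncation yields [N.+1]; the last
     interval, being closed, contains the coordinate. *)
  exists ord_max => /=.
  have : N.+1%:R <= j%:R :> R by rewrite ler_nat.
  by rewrite -natr1 in tE *; nra.
exists [ffun i => projT1 (cid (key i))] => i.
by rewrite !mxE ffunE; case: cid.
Qed.

Lemma cube_interior a h (x : V) i : (cube a h)^° x -> a 0 i < x 0 i < a 0 i + h.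
Proof.
move=> /nbhs_ballP[e /= e0 xe].
have H s : `|s| < e -> a 0 i <= x 0 i + s <= a 0 i + h.
  move=> se; have := xe (x + const_mx s) _ i; rewrite !mxE; apply.
  by split => // p q; rewrite -ball_normE /= !mxE opprD addrA subrr add0r normrN.
have e2 : `|e / 2| < e by rewrite ger0_norm; lra.
have e2' : `|- (e / 2)| < e by rewrite normrN.
by have := H _ e2; have := H _ e2'; lra.
Qed.

Lemma cell_nonoverlapping a h N k l : k != l ->
  nonoverlapping (@cell a h N k) (@cell a h N l).
Proof.
move=> kl; apply/seteqP; split => // x [kx lx] /=.
have [i ki] : exists i, k i != l i.
  by apply/existsP; apply: contraNT kl; rewrite negb_exists => /forallP kl;
    apply/eqP/ffunP => i; have := kl i; rewrite negbK => /eqP.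
have := cube_interior i kx; have := cube_interior i lx; rewrite !mxE.
set t := h / _ => lxi kxi.
have t0 : 0 < t by lra.
have [ltkl|ltlk|/val_inj eqkl] := ltngtP (k i) (l i).
- have : (k i)%:R + 1 <= (l i)%:R :> R by rewrite natr1 ler_nat.
  by nra.
- have : (l i)%:R + 1 <= (k i)%:R :> R by rewrite natr1 ler_nat.
  by nra.
- by rewrite eqkl eqxx in ki.
Qed.

Lemma count_nat_itv_le (N : nat) (lo hi : R) : 0 <= hi - lo + 1 ->
  \sum_(j < N | lo <= j%:R <= hi) (1 : R) <= hi - lo + 1.
Proof.
move=> lohi.
(* Strengthened for the induction: [hi] is cut off at the largest index [N - 1], and the maximum
   with 0 accounts for an empty count. *)
suff : \sum_(j < N | lo <= j%:R <= hi) (1 : R)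
    <= Num.max 0 (Num.min hi (N%:R - 1) - lo + 1).
  by move/le_trans; apply; rewrite ge_max lohi /= lerD2r lerD2r ge_min lexx.
elim: N => [|N ih]; first by rewrite big_ord0 le_max lexx.
rewrite big_mkcond big_ord_recr /= -big_mkcond.
rewrite -natr1 addrK; case: ifPn => [/andP[loN Nhi]|_].
  have -> : Num.min hi N%:R = N%:R by exact: min_r.
  apply: le_trans (lerD ih (lexx _)) _.
  rewrite [leRHS]max_r; last by lra.
  have : Num.min hi (N%:R - 1) <= N%:R - 1 by rewrite ge_min lexx orbT.
  by rewrite -lerBrDr ge_max; lra.
rewrite addr0 (le_trans ih)// ge_max !le_max lexx /=; apply/orP; right.
by rewrite !lerD2r le_min !ge_min lexx /= lerBlDr lerDl ler01 orbT.
Qed.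

End grid.

(** * Nullity of sets with small density in the cells of arbitrarily fine subdivisions *)

Section density.
Variables (R : realType) (n : nat).
Local Notation V := 'rV[R]_n.+1.
Implicit Types (a : V) (h : R) (B : V * V) (E : set V).

(** Cells that meet the box lie in its enlargement by one mesh on every side. Instead of comparing
    measures, indices are counted one coordinate at a time. *)
Lemma sum_cell_le a h N B : 0 < h -> is_box B ->
  \sum_(k | `[< @cell R n a h N k `&` box_set B !=set0 >]) (h / N.+1%:R) ^+ n.+1
  <= \prod_i (B.2 0 i - B.1 0 i + 2 * (h / N.+1%:R)).
Proof.
move=> h0 bB; set t := h / _; have t0 : 0 < t by rewrite divr_gt0.
(* The [i]-th index of a cell meeting the box lies in [[lo i, hi i]]; the [- 1] lets the cell begin
   up to one mesh before the box. *)
pose lo i := (B.1 0 i - a 0 i) / t - 1; pose hi i := (B.2 0 i - a 0 i) / t.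
pose Q i (j : 'I_N.+1) := lo i <= j%:R <= hi i.
have lohi i : hi i - lo i + 1 = (B.2 0 i - B.1 0 i) / t + 2.
  by rewrite /hi /lo; field; rewrite gt_eqF.
apply: (@le_trans _ _ (\sum_(k in family Q) \prod_(i < n.+1) t)).
  rewrite prodr_const card_ord big_mkcond [leRHS]big_mkcond; apply: ler_sum => k _.
  case: asboolP => [[x [kx Bx]]|_]; last
    by case: ifP => // _; rewrite exprn_ge0// ltW.
  rewrite ifT//; apply/familyP => i; rewrite unfold_in /lo /hi.
  rewrite lerBlDr ler_pdivrMr// ler_pdivlMr//.
  have := kx i; have := Bx i; rewrite !mxE -/t; nra.
rewrite -(bigA_distr_big_dep Q (fun=> fun=> t)); apply: ler_prod => i _.
rewrite sumr_ge0//=; last by move=> *; exact: ltW.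
rewrite (eq_bigr (fun=> t * 1)); last by move=> *; rewrite mulr1.
rewrite -mulr_sumr.
have lohi0 : 0 <= hi i - lo i + 1.
  rewrite lohi addr_ge0//; apply: divr_ge0; last exact: ltW.
  by rewrite subr_ge0; exact: bB.
apply: le_trans (ler_wpM2l (ltW t0) (count_nat_itv_le _ lohi0)) _.
by rewrite lohi mulrDr mulrC divfK ?gt_eqF// [t * 2]mulrC.
Qed.

(** On a subdivision with the density bound, the part of [E] in the box is covered by the traces of
    [E] on the cells meeting the box. These add up to at most [theta] times the volume of a slightly
    enlarged box, and the enlargement vanishes along arbitrarily fine subdivisions. *)
Lemma outer_measure_box_density E a h (theta : R) B : 0 < h -> E `<=` cube a h ->
  0 <= theta -> is_box B ->
  (forall N0, exists N, (N0 <= N)%N /\ forall k,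
     (lebesgue_outer (E `&` @cell R n a h N k) <=
      theta%:E * lebesgue_outer (@cell R n a h N k))%E) ->
  (lebesgue_outer (E `&` box_set B) <= (theta * box_vol B)%:E)%E.
Proof.
move=> h0 Ea th0 bB dens.
pose v (N : nat) := theta * \prod_i (B.2 0 i - B.1 0 i + 2 * (h / N.+1%:R)).
have vcvg : v @ \oo --> theta * box_vol B.
  apply: cvgMr; apply: cvg_big => [|i _]; first exact: mul_continuous.
  rewrite -[X in _ --> X]addr0; apply: cvgD; first exact: cvg_cst.
  rewrite (_ : (fun N : nat => _) = (fun N => 2 * h * harmonic N)).
    by rewrite -[X in _ --> X](mulr0 (2 * h)); apply: cvgMr; exact: cvg_harmonic.
  by apply/funext => N; rewrite mulrA.
have main N0 : exists2 N, (N0 <= N)%N &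
    (lebesgue_outer (E `&` box_set B) <= (v N)%:E)%E.
  have [N [N0N densN]] := dens N0; exists N => //.
  apply: (@le_trans _ _ (\sum_(k | `[< @cell R n a h N k `&` box_set B !=set0 >])
     lebesgue_outer (E `&` cell a h k))%E).
    apply: le_outer_measure_bigsetU => x [Ex Bx].
    have [k kx] := cell_cover N h0 (Ea _ Ex); exists k => //.
    by apply/asboolP; exists x.
  apply: (@le_trans _ _ (\sum_(k | `[< @cell R n a h N k `&` box_set B !=set0 >])
     (theta * (h / N.+1%:R) ^+ n.+1)%:E)%E).
    apply: lee_sum => k _; apply: le_trans (densN k) _.
    by rewrite EFinM lee_wpmul2l ?lee_fin// lebesgue_outer_cube_le// divr_ge0// ltW.
  by rewrite sumEFin lee_fin -mulr_sumr ler_wpM2l// sum_cell_le.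
rewrite leNgt; apply/negP => lt.
have fin : lebesgue_outer (E `&` box_set B) \is a fin_num.
  by apply: (lebesgue_outer_fin_num (ltW h0) (a := a)) => x [/Ea].
move: lt; rewrite -(fineK fin) lte_fin => lt.
have /cvgrPdist_lt /(_ (fine (lebesgue_outer (E `&` box_set B)) -
  theta * box_vol B)) := vcvg.
rewrite subr_gt0 => /(_ lt) [N0 _ HN0].
have [N /HN0 /= ] := main N0.
rewrite -(fineK fin) lee_fin => + ?; rewrite ltr_norml; lra.
Qed.

(* A covering argument in place of the Lebesgue density theorem: the boxes of
   an almost optimal cover of [E] are filled with cells, each of which meets
   [E] in at most a proportion [theta]; hence [E] has measure at most [theta]
   times its own measure. *)
Lemma outer_measure_density_eq0 E a h (theta : R) : 0 < h -> E `<=` cube a h ->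
  0 <= theta < 1 ->
  (forall N0, exists N, (N0 <= N)%N /\ forall k,
     (lebesgue_outer (E `&` @cell R n a h N k) <=
      theta%:E * lebesgue_outer (@cell R n a h N k))%E) ->
  lebesgue_outer E = 0%E.
Proof.
move=> h0 Ea /andP[th0 th1] dens.
have fin := lebesgue_outer_fin_num (ltW h0) Ea.
have cov F : box_cover E F ->
    (lebesgue_outer E <= theta%:E * \sum_(k <oo) (box_vol (F k))%:E)%E.
  move=> [bF EF].
  rewrite -nneseriesZl; last by move=> k _; rewrite lee_fin box_vol_ge0.
  apply: (@le_trans _ _
    (\sum_(k <oo) lebesgue_outer (E `&` box_set (F k)))%E); last first.
    apply: lee_nneseries => k *; first exact: outer_measure_ge0.
    by rewrite -EFinM; exact: (outer_measure_box_density h0 Ea th0 (bF k) dens).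
  apply: le_trans (outer_measure_sigma_subadditive _ _).
  apply: le_outer_measure => x Ex; have [k _ Fk] := EF _ Ex.
  by exists k.
set m := fine (lebesgue_outer E).
have mE : lebesgue_outer E = m%:E by rewrite fineK.
have m0 : 0 <= m by rewrite -lee_fin -mE outer_measure_ge0.
rewrite mE; congr EFin; apply/eqP; rewrite eq_le m0 andbT leNgt.
apply/negP => m_gt0.
(* A cover of total volume below [m + (1 - theta) * m] gives [m <= theta * (2 - theta) * m], where
   [theta * (2 - theta) < 1]. *)
have e0 : 0 < (1 - theta) * m by nra.
have [_ [F cF <-]] := lb_ereal_inf_adherent e0 fin.
rewrite -/(lebesgue_outer E) mE -EFinD => ltF.
have := le_trans (cov F cF) (lee_wpmul2l (_ : (0 <= theta%:E)%E) (ltW ltF)).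
rewrite lee_fin mE -EFinM lee_fin => /(_ th0).
nra.
Qed.

End density.

(** * Maximal medians and constants extracted from [Omega] *)

Section medians.
Variables (R : realType) (n : nat).
Local Notation V := 'rV[R]_n.+1.
Local Notation mu := (@lebesgue_outer R n).
Implicit Types (f g : V -> R) (Q X : set V) (s t : R).

Lemma max_median_ge0 g s Q : 0 <= s -> (forall x, 0 <= g x) ->
  0 <= max_median g s Q.
Proof.
move=> s0 g0; rewrite /max_median; set S := [set M | _].
have S0 : S 0.
  rewrite /S /= (_ : _ `&` _ = set0).
    by rewrite outer_measure0 mule_ge0 ?outer_measure_ge0.
  by apply/seteqP; split => // y [_ /=]; rewrite ltNge g0.
(* An unbounded set of thresholds gives [sup] its default value 0. *)
have [supS|nsupS] := pselect (has_sup S); first exact: sup_upper_bound.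
by rewrite sup_out.
Qed.

Lemma max_median_le g s Q (w : R) : 0 <= s -> 0 <= w -> (forall x, 0 <= g x) ->
  (forall M, w < M -> (s%:E * mu Q < mu (Q `&` [set y | g y < M]%R))%E) ->
  max_median g s Q <= w.
Proof.
move=> s0 w0 g0 H; rewrite /max_median; set S := [set M | _].
have [[S0 _]|nsupS] := pselect (has_sup S); last by rewrite sup_out.
apply: ge_sup => // M; rewrite /S /= => SM.
by rewrite leNgt; apply/negP => /H; rewrite ltNge SM.
Qed.

(** The hypothesis on [K] bounds the thresholds from above, so that [max_median] is a genuine
    supremum and not a default value; any [M] beyond it then fails to be a threshold. *)
Lemma lt_max_median g s Q (K M : R) :
  (s%:E * mu Q < mu (Q `&` [set y | g y < K]%R))%E -> max_median g s Q < M ->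
  (s%:E * mu Q < mu (Q `&` [set y | g y < M]%R))%E.
Proof.
move=> QK; rewrite ltNge => /negP ltM; rewrite ltNge; apply/negP => leM; apply: ltM.
apply: ub_le_sup => //; exists K => M' /= leM'.
rewrite leNgt; apply/negP => KM'; move: QK; rewrite ltNge => /negP; apply.
apply: le_trans leM'; apply: le_outer_measure => y [Qy /= gK]; split => //=.
exact: lt_trans KM'.
Qed.

Lemma Omega_lt_const Q f s (d e : R) Q1 Q2 : (Omega Q f s d < e%:E)%E ->
  admissible Q d (Q1, Q2) ->
  exists c, Psi s (fun x => `|f x - c|) Q1 Q2 < e.
Proof.
move=> Oe adm.
have /ereal_inf_lt[_ [c _ <-] ce] : (ereal_inf
   [set (Psi s (fun x => `|f x - c|) Q1 Q2)%:E | c in [set: R]] < e%:E)%E.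
  apply: le_lt_trans Oe; apply: ereal_sup_ubound.
  by exists (Q1, Q2).
by exists c; rewrite -lte_fin.
Qed.

Lemma Psi_sym s g Q1 Q2 : Psi s g Q1 Q2 = Psi s g Q2 Q1.
Proof. by rewrite /Psi setUC addrC. Qed.

(* Cubes of equal size have weights at least 1/2 each. *)
Lemma max_median_lt_Psi s g (a b : V) t (e : R) : 0 <= s -> 0 <= t ->
  (forall x, 0 <= g x) -> mu (cube a t) != 0%E ->
  Psi s g (cube a t) (cube b t) < e -> max_median g s (cube a t) < 2 * e.
Proof.
move=> s0 t0 g0 ma0; rewrite /Psi /volume.
set u := fine (mu (_ `|` _)).
rewrite (lebesgue_outer_cube_translate b a).
have m1 := max_median_ge0 (cube a t) s0 g0.
have m2 := max_median_ge0 (cube b t) s0 g0.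
have fin c : mu (cube c t) \is a fin_num
  := lebesgue_outer_fin_num t0 (@subset_refl _ (cube c t)).
set v := fine (mu (cube a t)).
have v0 : 0 < v.
  by rewrite /v lt_neqAle fine_ge0 ?outer_measure_ge0// eq_sym fine_eq0 ?ma0.
have finu : mu (cube a t `|` cube b t) \is a fin_num.
  rewrite ge0_fin_numE ?outer_measure_ge0//.
  apply: le_lt_trans (outer_measureU2 _ _ _) _.
  by apply: lte_add_pinfty; rewrite -ge0_fin_numE ?outer_measure_ge0//; exact: fin.
have vu : v <= u.
  by rewrite fine_le//; apply: le_outer_measure => x; left.
have u2v : u <= 2 * v.
  have : (mu (cube a t `|` cube b t) <= mu (cube a t) + mu (cube b t))%E
    := outer_measureU2 _ _ _.
  rewrite (lebesgue_outer_cube_translate b a) -(fineK finu) -(fineK (fin a)).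
  by rewrite -EFinD lee_fin -/u -/v; lra.
have u0 : 0 < u by lra.
have : v / u >= 1 / 2 by rewrite ler_pdivlMr//; lra.
have : 0 <= v / u by rewrite divr_ge0 ?ltW.
nra.
Qed.

(** One [c] makes the weighted sum of the two medians small; as each weight is at least 1/2, each
    median is below [2 * e]. *)
Lemma Omega_lt_common_const Q f s (d e : R) (a b : V) t : 0 <= s -> 0 < t ->
  (Omega Q f s d < e%:E)%E -> admissible Q d (cube a t, cube b t) ->
  mu (cube a t) != 0%E ->
  (forall c, exists K, (s%:E * mu (cube a t) <
     mu (cube a t `&` [set y | `|f y - c| < K]%R))%E) ->
  (forall c, exists K, (s%:E * mu (cube b t) <
     mu (cube b t `&` [set y | `|f y - c| < K]%R))%E) ->
  exists c,
    (s%:E * mu (cube a t) < mu (cube a t `&` [set y | `|f y - c| < 2 * e]%R))%E /\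
    (s%:E * mu (cube b t) < mu (cube b t `&` [set y | `|f y - c| < 2 * e]%R))%E.
Proof.
move=> s0 t0 Oe adm ma0 ba bb; have [c ce] := Omega_lt_const Oe adm.
exists c; have [Ka aK] := ba c; have [Kb bK] := bb c; split.
  apply: lt_max_median aK _.
  by apply: max_median_lt_Psi ce => //; exact: ltW.
apply: lt_max_median bK _.
move: ce; rewrite Psi_sym => ce; apply: max_median_lt_Psi ce => //.
- exact: ltW.
- by rewrite (lebesgue_outer_cube_translate b a).
Qed.

End medians.

(** * Maximum norm, Euclidean diameter and adjacent cells *)

Section geometry.
Variables (R : realType) (n : nat).
Local Notation V := 'rV[R]_n.+1.
Local Notation mu := (@lebesgue_outer R n).
Implicit Types (a x y : V) (h r : R).

Lemma coord_le_norm (v : V) i : `|v 0 i| <= `|v|.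
Proof.
by rewrite [leRHS]/Num.Def.normr/= mx_normrE; exact: (le_bigmax _ _ (0, i)).
Qed.

Lemma rV_norm_le (v : V) r : 0 <= r -> (forall i, `|v 0 i| <= r) -> `|v| <= r.
Proof.
move=> r0 vr; rewrite [leLHS]/Num.Def.normr/= mx_normrE (bigmax_le _ r0)//=.
by move=> [i j] _; rewrite (ord1 i).
Qed.

Lemma euclidean_dist_le x y : euclidean_dist x y <= n.+1%:R * `|x - y|.
Proof.
have D1 : 1 <= n.+1%:R :> R by rewrite ler1n.
have d0 := normr_ge0 (x - y).
rewrite -[leRHS]ger0_norm; last by rewrite mulr_ge0.
rewrite -sqrtr_sqr; apply: ler_wsqrtr.
apply: (@le_trans _ _ (\sum_(i < n.+1) `|x - y| ^+ 2)).
  apply: ler_sum => i _; have := coord_le_norm (x - y) i; rewrite !mxE => xy.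
  by rewrite -real_normK ?num_real// lerXn2r ?nnegrE.
rewrite sumr_const card_ord -[leLHS]mulr_natl exprMn ler_wpM2r ?exprn_ge0//.
by rewrite expr2 ler_pMr.
Qed.

Lemma norm_le_euclidean_dist x y : `|x - y| <= euclidean_dist x y.
Proof.
apply: rV_norm_le => [|i]; first exact: sqrtr_ge0.
rewrite -sqrtr_sqr; apply: ler_wsqrtr; rewrite (bigD1 i)//= !mxE lerDl.
by apply: sumr_ge0 => j _; exact: sqr_ge0.
Qed.

Lemma diam_le (X : set V) r : 0 <= r ->
  (forall x y, X x -> X y -> `|x - y| <= r) -> diam X <= n.+1%:R * r.
Proof.
move=> r0 Xr; rewrite /diam; set S := (X in sup X).
have [[S0 _]|?] := pselect (has_sup S); last by rewrite sup_out// mulr_ge0.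
apply: ge_sup => // _ [x Xx] [y Xy] <-.
by rewrite (le_trans (euclidean_dist_le _ _))// ler_wpM2l// Xr.
Qed.

Lemma cube_norm_le a h x y : cube a h x -> cube a h y -> `|x - y| <= h.
Proof.
move=> ax ay; apply: rV_norm_le => [|i].
  by have := ax ord0; lra.
by rewrite !mxE ler_norml; have := ax i; have := ay i; lra.
Qed.

(** Containment in a cube bounds the set of distances, so that [diam] is a genuine supremum. *)
Lemma norm_le_diam a h (X : set V) x y : X `<=` cube a h -> X x -> X y ->
  `|x - y| <= diam X.
Proof.
move=> Xa Xx Xy; apply: le_trans (norm_le_euclidean_dist x y) _.
apply: ub_le_sup; last by exists x => //; exists y.
exists (n.+1%:R * h) => _ [z Xz] [w Xw] <-.
rewrite (le_trans (euclidean_dist_le _ _))// ler_wpM2l//.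
by apply: (@cube_norm_le a); exact: Xa.
Qed.

Lemma is_cube_cube a h : 0 < h -> is_cube (cube a h).
Proof. by move=> h0; exists a, h. Qed.

(** All cells of a subdivision are translates of one another, so one null cell would make the whole
    cube null. *)
Lemma lebesgue_outer_cell_neq0 a h N k : 0 < h -> mu (cube a h) != 0%E ->
  mu (@cell R n a h N k) != 0%E.
Proof.
move=> h0; apply: contra_neq => k0; apply/eqP.
rewrite eq_le outer_measure_ge0 andbT.
apply: (@le_trans _ _ (\sum_(l | true) mu (@cell R n a h N l))%E).
  apply: le_outer_measure_bigsetU => x /(cell_cover N h0)[l lx].
  by exists l.
by rewrite big1// => l _; rewrite -[RHS]k0; exact: lebesgue_outer_cube_translate.
Qed.

Lemma near_mesh_le h r : 0 < r ->
  exists N0, forall N, (N0 <= N)%N -> h / N.+1%:R <= r.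
Proof.
move=> r0; have : (h / N.+1%:R) @[N --> \oo] --> (0 : R).
  by rewrite -[X in _ --> X](mulr0 h); apply: cvgMr; exact: cvg_harmonic.
move/cvgrPdist_le => /(_ _ r0) [N0 _ N0r]; exists N0 => N /N0r /=.
by rewrite sub0r normrN; exact: le_trans (ler_norm _).
Qed.

(** Supplies a nearby partner for a given cell, since [Omega] speaks of pairs of cubes. *)
Lemma cell_adjacent a h N k : 0 < h -> (0 < N)%N -> exists2 l, l != k &
  forall x y, @cell R n a h N k x -> @cell R n a h N l y ->
    `|x - y| <= 2 * (h / N.+1%:R).
Proof.
move=> h0 N0; set t := h / _; have t0 : 0 < t by rewrite divr_gt0.
(* The neighbour is taken in direction [ord0]: index 1 if the given index is 0, its predecessor
   otherwise. Index 1 exists because [0 < N] means at least two parts per side. *)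
pose j := if k ord0 == 0 :> nat then 1%N else (k ord0).-1.
have jN : (j < N.+1)%N.
  by rewrite /j; case: ifP => // _; rewrite (leq_ltn_trans (leq_pred _)).
exists [ffun i => if i == ord0 then Ordinal jN else k i].
  apply/eqP => /ffunP/(_ ord0); rewrite ffunE eqxx => /(congr1 val) /= /eqP.
  rewrite /j; case: ifPn => [/eqP ->//|]; rewrite -lt0n => k0.
  by rewrite -[X in _ == X](prednK k0) ltn_eqF.
move=> x y kx ly; apply: rV_norm_le => [|i]; first by rewrite mulr_ge0 ?ltW.
have := kx i; have := ly i; rewrite !mxE ffunE -/t ler_norml.
case: ifP => [/eqP ->|_]; last by lra.
rewrite /= /j; case: eqP => [->|/eqP]; first by lra.
rewrite -lt0n => k0; rewrite -{3 4}(prednK k0) -natr1; nra.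
Qed.

End geometry.

(** * From small [Omega] to small essential oscillation *)

Section oscillation.
Variables (R : realType) (n : nat).
Local Notation V := 'rV[R]_n.+1.
Local Notation mu := (@lebesgue_outer R n).
Variables (a : V) (h s K : R) (f : V -> R).
Local Notation Q0 := (cube a h).
Hypothesis h0 : 0 < h.
Hypothesis s01 : 2^-1 < s < 1.
Hypothesis mf : measurable_fun (Q0 : set (Leb R n)) (f : Leb R n -> R).
Hypothesis fK : mu (Q0 `&` [set y | K < `|f y|]) = 0%E.
Hypothesis Q0_neq0 : mu Q0 != 0%E.
Implicit Types (x : V) (c e r : R) (T : set V).

Let mostly T c e := (s%:E * mu T < mu (T `&` [set y | `|f y - c| < e]%R))%E.

Let measurable_near T c e : T `<=` Q0 -> measurable (T : set (Leb R n)) ->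
  measurable (T `&` [set y | `|f y - c| < e] : set (Leb R n)).
Proof.
move=> TQ mT.
rewrite (_ : _ `&` _ = T `&` (Q0 `&` f @^-1` `]c - e, c + e[%classic)).
  apply: (@measurableI _ (Leb R n)) => //.
  by apply: mf; [exact: measurable_cube|exact: measurable_itv].
apply/seteqP; split => y /=; rewrite in_itv/= -ltr_distlC distrC.
  by move=> [Ty ye]; split => //; split => //; exact: TQ.
by move=> [Ty [_ ye]].
Qed.

(** Provides the threshold that [lt_max_median] asks for: where [|f y| <= K], hence almost
    everywhere, [f] is at distance at most [K + |c|] from [c]. *)
Let bounded_mostly T : T `<=` Q0 -> mu T != 0%E -> forall c, exists e, mostly T c e.
Proof.
move=> TQ T0 c; exists (K + `|c| + 1); rewrite /mostly.
have fin := lebesgue_outer_fin_num (ltW h0) TQ.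
apply: (@lt_le_trans _ _ (mu T)).
  rewrite -[ltRHS]mul1e lte_pmul2r// ?lte_fin ?(andP s01).2//.
  by rewrite lt_neqAle eq_sym T0 outer_measure_ge0.
rewrite -[leRHS]adde0 -fK; apply: le_trans (outer_measureU2 _ _ _).
apply: le_outer_measure => y Ty; have [Ky|yK] := ltP K `|f y|; [right|left].
  by split => //; exact: TQ.
by split => //=; have := ler_normB (f y) c; lra.
Qed.

(** Otherwise two disjoint measurable subsets of [T] would together fill more than a proportion
    [2 * s] of it, and [2 * s > 1]. *)
Let mostly_close T c c' e e' : T `<=` Q0 -> measurable (T : set (Leb R n)) ->
  mostly T c e -> mostly T c' e' -> `|c - c'| < e + e'.
Proof.
move=> TQ mT; rewrite /mostly => ce ce'; rewrite ltNge; apply/negP => far.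
have [finT fin fin'] : [/\ mu T \is a fin_num,
    mu (T `&` [set y | `|f y - c| < e]) \is a fin_num &
    mu (T `&` [set y | `|f y - c'| < e']) \is a fin_num].
  split; apply: (lebesgue_outer_fin_num (ltW h0) (a := a)) => //.
  - by move=> y [/TQ].
  - by move=> y [/TQ].
have : (mu (T `&` [set y | `|f y - c| < e]%R) +
        mu (T `&` [set y | `|f y - c'| < e']%R) <= mu T)%E.
  rewrite [leRHS](measurable_near c e TQ mT); apply: leeD; apply: le_outer_measure.
    by move=> y [Ty ye].
  move=> y [Ty /= ye']; split => // -[_ /= ye].
  by have := ler_normD (c - f y) (f y - c'); rewrite subrKA (distrC c (f y)); lra.
move: ce ce'; rewrite -(fineK finT) -(fineK fin) -(fineK fin') -EFinM -EFinD.
rewrite !lte_fin lee_fin.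
have : 0 <= fine (mu T) by rewrite fine_ge0// outer_measure_ge0.
by move: s01; nra.
Qed.

Let mostlyC T c e : T `<=` Q0 -> measurable (T : set (Leb R n)) -> mostly T c e ->
  (mu (T `&` [set y | e <= `|f y - c|]%R) <= (1 - s)%:E * mu T)%E.
Proof.
move=> TQ mT ce.
have : (mu (T `&` [set y | `|f y - c| < e]%R) +
        mu (T `&` [set y | e <= `|f y - c|]%R) <= mu T)%E.
  rewrite [leRHS](measurable_near c e TQ mT); apply: leeD; apply: le_outer_measure.
    by move=> y [Ty ye].
  by move=> y [Ty /= ye]; split => // -[_ /=]; rewrite ltNge ye.
have [finT fin fin'] : [/\ mu T \is a fin_num,
    mu (T `&` [set y | `|f y - c| < e]) \is a fin_num &
    mu (T `&` [set y | e <= `|f y - c|]) \is a fin_num].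
  split; apply: (lebesgue_outer_fin_num (ltW h0) (a := a)) => //.
  - by move=> y [/TQ].
  - by move=> y [/TQ].
move: ce; rewrite /mostly -(fineK finT) -(fineK fin) -(fineK fin') -!EFinM -EFinD.
rewrite !lte_fin !lee_fin; lra.
Qed.

Section fixed_scale.
Variables (e eta r : R) (x : V).
Hypothesis e0 : 0 < e.
Hypothesis Omega_e : (Omega Q0 f s eta < e%:E)%E.
Hypothesis r0 : 0 < r.
Hypothesis r_eta : n.+1%:R * (4 * r) <= eta.
Hypothesis Q0x : Q0 x.

(** For mesh at most [r], the radius [2 * r] admits every cell meeting the ball of radius [r] about
    [x], as well as a neighbour of the cell of [x]. Two near cells have points at most [4 * r]
    apart, whence the form of [r_eta]. *)
Let near_cell N (k : {ffun 'I_n.+1 -> 'I_N.+1}) :=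
  forall y, cell a h k y -> `|y - x| <= 2 * r.

Let near_cell_common N (k l : {ffun 'I_n.+1 -> 'I_N.+1}) : k != l ->
  near_cell k -> near_cell l ->
  exists c, mostly (cell a h k) c (2 * e) /\ mostly (cell a h l) c (2 * e).
Proof.
move=> kl xk xl.
have kQ := @cell_subset R n a h N k h0; have lQ := @cell_subset R n a h N l h0.
apply: (Omega_lt_common_const _ _ Omega_e).
- by move: s01; lra.
- by rewrite divr_gt0.
- split => //=; first by split; apply: is_cube_cube; rewrite divr_gt0.
    exact: cell_nonoverlapping.
  apply: le_trans r_eta; apply: diam_le; first by rewrite mulr_ge0 ?ltW.
  have near y : (cell a h k `|` cell a h l) y -> `|y - x| <= 2 * r by case; auto.
  move=> y z /near yx /near zx.
  have := ler_normD (y - x) (x - z); rewrite subrKA (distrC x); lra.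
- exact: lebesgue_outer_cell_neq0.
- by apply: bounded_mostly => //; exact: lebesgue_outer_cell_neq0.
- by apply: bounded_mostly => //; exact: lebesgue_outer_cell_neq0.
Qed.

Let grid_const N : (0 < N)%N -> h / N.+1%:R <= r ->
  exists c, `|c| <= K + 2 * e /\
    forall k : {ffun 'I_n.+1 -> 'I_N.+1}, near_cell k ->
      mostly (cell a h k) c (6 * e).
Proof.
move=> N0 tr; have [k kx] := cell_cover N h0 Q0x.
have kQ := @cell_subset R n a h N k h0.
have xk : near_cell k.
  by move=> y ky; have := le_trans (cube_norm_le ky kx) tr; move: r0; lra.
have [l lk klx] := cell_adjacent a k h0 N0.
have xl : near_cell l.
  move=> y ly; rewrite distrC; apply: le_trans (klx _ _ kx ly) _.
  by rewrite ler_pM2l.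
have [c [ck _]] : exists c, mostly (cell a h k) c (2 * e) /\
    mostly (cell a h l) c (2 * e).
  by apply: near_cell_common => //; rewrite eq_sym.
have mk : measurable (cell a h k : set (Leb R n)) by exact: measurable_cube.
have mostlyW T c' e1 e2 : e1 <= e2 -> mostly T c' e1 -> mostly T c' e2.
  move=> e12 /lt_le_trans; apply; apply: le_outer_measure => y [Ty /= ye].
  by split => //=; lra.
exists c; split.
  (* The part of the cell where [f] is near [c] is not null, hence not contained in the null set
     where [K < |f y|]. The resulting bound confines the constants of all fine subdivisions to one
     segment. *)
  have [y [ky /= yc] yK] : exists2 y,
      (cell a h k `&` [set y | `|f y - c| < 2 * e]) y & `|f y| <= K.
    apply: contrapT => /forall2NP far.
    move: ck; rewrite /mostly ltNge => /negP; apply.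
    apply: (@le_trans _ _ 0%E).
      rewrite -fK; apply: le_outer_measure => y yc.
      have [|/negP] := far y => // yK; split; first exact: kQ yc.1.
      by rewrite /= ltNge.
    by rewrite mule_ge0 ?outer_measure_ge0// lee_fin; move: s01; lra.
  by have := ler_normB (f y) (f y - c); rewrite opprB addrC subrK; lra.
(* The cells [j] and [k] share a constant [c']. Both [c] and [c'] serve [k], so they are less than
   [4 * e] apart, and [2 * e + 4 * e = 6 * e]. *)
move=> j xj; have [->|kj] := eqVneq j k; first by apply: mostlyW ck; move: e0; lra.
have [c' [ck' cj']] := near_cell_common kj xj xk.
have cc' := mostly_close kQ mk ck cj'.
apply: lt_le_trans ck' _; apply: le_outer_measure => y [jy /= ye]; split => //=.
have := ler_normD (f y - c') (c' - c); rewrite subrKA (distrC c' c); lra.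
Qed.

Lemma small_scale_const : exists c,
  mu (Q0 `&` [set y | `|y - x| <= r /\ 7 * e <= `|f y - c|]) = 0%E.
Proof.
have [N1 tr] := near_mesh_le h r0.
have /choice[c cP] N : exists c, (maxn N1 1 <= N)%N -> `|c| <= K + 2 * e /\
    forall k : {ffun 'I_n.+1 -> 'I_N.+1}, near_cell k ->
      mostly (cell a h k) c (6 * e).
  have [|?] := boolP (maxn N1 1 <= N)%N; last by exists 0.
  rewrite geq_max => /andP[N1N N0].
  by have [c cN] := grid_const N0 (tr _ N1N); exists c.
pose L := K + 2 * e.
(* The constants stay in [[- L, L]] from some index on, so they have a cluster point [d]. *)
have /(_ (c @ \oo) _ _)[] := @segment_compact R (- L) L.
  exists (maxn N1 1) => // N /= /cP[cL _].
  by rewrite in_itv/= -ler_norml.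
move=> d [_ dclu]; exists d.
apply: (@outer_measure_density_eq0 R n _ a h (1 - s)) => //.
- by move: s01; lra.
move=> N0; pose N2 := maxn N0 (maxn N1 1).
have cN2 : (c @ \oo) (c @` [set N | (N2 <= N)%N]).
  by exists N2 => // N N2N; exists N.
(* For arbitrarily large [N] the constant [c N] is within [e] of [d], which turns [6 * e] into
   [7 * e]. *)
have [_ [[N /= N2N <-] /= dc]] := dclu _ _ cN2 (nbhsx_ballx d e e0).
move: N2N; rewrite geq_max => /andP[N0N N1N].
exists N; split => // k.
have [_ cN] := cP N N1N.
(* A cell that meets the exceptional set is near [x], so [mostlyC] applies to it; any other cell
   satisfies the density bound trivially. *)
have [[y [[Q0y [yx ye]] ky]]|nok] := pselect (exists y,
    (Q0 `&` [set y | `|y - x| <= r /\ 7 * e <= `|f y - d|] `&` cell a h k) y).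
  have kQ := @cell_subset R n a h N k h0.
  apply: le_trans (mostlyC kQ (measurable_cube _ _) (cN k _)).
    apply: le_outer_measure => z [[Qz [zx ze]] kz]; split => //=.
    move: dc; rewrite -ball_normE /=.
    have := ler_normD (f z - c N) (c N - d); rewrite subrKA (distrC (c N)); lra.
  have tNr : h / N.+1%:R <= r by apply: tr; exact: leq_trans (leq_maxl _ _) N1N.
  move=> z kz; have zy := le_trans (cube_norm_le kz ky) tNr.
  have := ler_normD (z - y) (y - x); rewrite subrKA => /le_trans; apply.
  by rewrite mulr2n mulrDl mul1r lerD.
rewrite (_ : _ `&` _ = set0).
  by rewrite outer_measure0 mule_ge0 ?outer_measure_ge0// lee_fin; move: s01; lra.
by apply/seteqP; split => // y yk; apply: nok; exists y.
Qed.

End fixed_scale.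

End oscillation.

(** * Null sets and almost everywhere equality *)

Section null_sets.
Variables (R : realType) (n : nat).
Local Notation V := 'rV[R]_n.+1.
Local Notation mu := (@lebesgue_outer R n).
Implicit Types (X Y : set V) (f g : V -> R).

Lemma lebesgue_outer_null_subset X Y : X `<=` Y -> mu Y = 0%E -> mu X = 0%E.
Proof.
move=> XY Y0; apply/eqP; rewrite eq_le outer_measure_ge0 andbT -Y0.
exact: le_outer_measure.
Qed.

Lemma lebesgue_outer_nullU X Y : mu X = 0%E -> mu Y = 0%E -> mu (X `|` Y) = 0%E.
Proof.
move=> X0 Y0; apply/eqP; rewrite eq_le outer_measure_ge0 andbT.
have : (mu (X `|` Y) <= mu X + mu Y)%E := outer_measureU2 _ _ _.
by rewrite X0 Y0 adde0.
Qed.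

Lemma measurable_null X : mu X = 0%E -> measurable (X : set (Leb R n)).
Proof.
move=> X0; apply: le_caratheodory_measurable => Y /=.
rewrite [X in (X + _)%E](lebesgue_outer_null_subset _ X0)// add0e.
by apply: le_outer_measure => y [].
Qed.

Lemma ae_eq_null Q f g :
  (f : Leb R n -> R) = g %[ae lebesgue_mx R n in (Q : set (Leb R n))] <->
  mu (Q `&` [set y | f y != g y]) = 0%E.
Proof.
split=> [[N [mN N0 fgN]]|fg0].
  apply: lebesgue_outer_null_subset N0 => y [Qy /= /eqP fgy].
  by apply: fgN => /= /(_ Qy).
exists (Q `&` [set y | f y != g y]); split => //; first exact: measurable_null.
move=> y /= /not_implyP[Qy /eqP fgy]; by split.
Qed.

End null_sets.

(** * Construction of the continuous representative *)

Section essential_oscillation.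
Variables (R : realType) (n : nat).
Local Notation V := 'rV[R]_n.+1.
Local Notation mu := (@lebesgue_outer R n).
Variables (a : V) (h : R) (f : V -> R).
Local Notation Q0 := (cube a h).
Hypothesis h0 : 0 < h.
Hypothesis Q0_neq0 : mu Q0 != 0%E.
Hypothesis osc : forall e, 0 < e -> exists2 r, 0 < r & forall x, Q0 x -> exists c,
  mu (Q0 `&` [set y | `|y - x| <= r /\ e <= `|f y - c|]) = 0%E.

Let exists_cell_small r : 0 < r -> exists N, h / N.+1%:R <= r.
Proof. by move=> /(near_mesh_le h)[N tr]; exists N; exact: tr. Qed.

(** For a fine enough mesh, the ball contains the whole cell around its centre. *)
Let ball_neq0 x r : Q0 x -> 0 < r -> mu (Q0 `&` [set y | `|y - x| <= r]) != 0%E.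
Proof.
move=> Qx r0.
have [N tr] := exists_cell_small r0.
have [k kx] := cell_cover N h0 Qx.
apply: contra_neq (lebesgue_outer_cell_neq0 k h0 Q0_neq0).
apply: lebesgue_outer_null_subset => y ky; split; first exact: cell_subset ky.
exact: le_trans (cube_norm_le ky kx) tr.
Qed.

Let ess_limsup x := inf [set t | exists2 r, 0 < r &
  mu (Q0 `&` [set y | `|y - x| <= r /\ t < f y]) = 0%E].

(** [c + e] is an essential upper bound of [f] near [x], and no [t < c - e] is one: a ball about [x]
    would be covered by two null sets. *)
Let ess_limsup_close x c e r : Q0 x -> 0 < r ->
  mu (Q0 `&` [set y | `|y - x| <= r /\ e <= `|f y - c|]) = 0%E ->
  `|ess_limsup x - c| <= e.
Proof.
move=> Qx r0 cr; rewrite /ess_limsup; set S := [set t | _].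
have Sc : S (c + e).
  exists r => //; apply: lebesgue_outer_null_subset cr => y [Qy [yx fy]].
  by split => //; split => //; have := ler_norm (f y - c); lra.
have lbS : lbound S (c - e).
  move=> t [r' r'0 tr']; rewrite leNgt; apply/negP => tc.
  have rr0 : 0 < Num.min r r' by rewrite lt_min r0.
  have /negP := ball_neq0 Qx rr0; apply; apply/eqP.
  apply: lebesgue_outer_null_subset (lebesgue_outer_nullU cr tr') => y [Qy /=].
  rewrite le_min => /andP[yr yr'].
  have [ey|ye] := leP e `|f y - c|; [left|right]; split => //; split => //.
  by move: ye; rewrite ltr_norml; lra.
have : c - e <= inf S by apply: lb_le_inf => //; exists (c + e).
have : inf S <= c + e by apply: ge_inf => //; exists (c - e).
by rewrite ler_norml; lra.
Qed.

Let is_value g := forall e, 0 < e -> exists2 r, 0 < r & forall x, Q0 x ->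
  mu (Q0 `&` [set y | `|y - x| <= r /\ e <= `|f y - g x|]) = 0%E.

Let exists_value : exists g, is_value g.
Proof.
exists ess_limsup => e e0.
have [|r r0 rosc] := osc (e := e / 2); first by rewrite divr_gt0.
exists r => // x Qx; have [c cr] := rosc _ Qx.
have := ess_limsup_close Qx r0 cr; set gx := ess_limsup x => gc.
apply: lebesgue_outer_null_subset cr => y [Qy [yx fy]]; split => //; split => //.
have := ler_normD (f y - c) (c - gx); rewrite subrKA (distrC c gx); lra.
Qed.

(** If [g x] and [g y] were more than [e] apart, no [f z] could be within [e / 2] of both; yet
    almost every [z] in the ball of radius [r / 2] about [x] has this property. *)
Let value_unif g e : is_value g -> 0 < e ->
  exists2 r, 0 < r & forall x y, Q0 x -> Q0 y -> `|x - y| <= r -> `|g x - g y| <= e.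
Proof.
move=> g_osc e0; have [|r r0 rosc] := g_osc (e / 2); first by rewrite divr_gt0.
exists (r / 2) => [|x y Qx Qy xy]; first by rewrite divr_gt0.
have r20 : 0 < r / 2 by rewrite divr_gt0.
rewrite leNgt; apply/negP => exy.
have /negP := ball_neq0 Qx r20; apply; apply/eqP.
apply: lebesgue_outer_null_subset (lebesgue_outer_nullU (rosc _ Qx) (rosc _ Qy)).
move=> z [Qz /= zx].
have zxr : `|z - x| <= r by lra.
have zyr : `|z - y| <= r.
  by have := ler_normD (z - x) (x - y); rewrite subrKA; lra.
have [ex|xe] := leP (e / 2) `|f z - g x|; first by left.
have ey : e / 2 <= `|f z - g y|.
  have := ler_normD (g x - f z) (f z - g y); rewrite subrKA (distrC (g x) (f z)).
  by lra.
by right.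
Qed.

Lemma equiv_continuous_osc : equiv_continuous Q0 f.
Proof.
have [g g_osc] := exists_value; exists g; split.
  apply/subspace_continuousP => x Qx; apply/cvgrPdist_le => e e0.
  have [r r0 gr] := value_unif g_osc e0; apply/nbhs_ballP; exists r => //= y.
  by rewrite -ball_normE /= => /ltW xy Qy; exact: gr.
have fg_e e : 0 < e -> mu (Q0 `&` [set y | e <= `|f y - g y|]) = 0%E.
  move=> e0; have e20 : 0 < e / 2 by rewrite divr_gt0.
  have [r1 r10 fr1] := g_osc _ e20; have [r2 r20 gr2] := value_unif g_osc e20.
  have rr0 : 0 < Num.min r1 r2 by rewrite lt_min r10.
  have [N tr] := exists_cell_small rr0.
  (* The null set in [is_value] depends on the point, so [g y] is replaced by the value of [g] at
     the lower corner of a cell containing [y]: only finitely many null sets then occur. *)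
  pose p (k : {ffun 'I_n.+1 -> 'I_N.+1}) : V :=
    \row_i (a 0 i + (k i)%:R * (h / N.+1%:R)).
  have t0 : 0 <= h / N.+1%:R by rewrite divr_ge0 ?ltW.
  have kp k : cell a h k (p k) by move=> i; rewrite lexx lerDl.
  pose X k := Q0 `&` [set y | `|y - p k| <= r1 /\ e / 2 <= `|f y - g (p k)|].
  apply/eqP; rewrite eq_le outer_measure_ge0 andbT.
  apply: (@le_trans _ _ (\sum_(k | true) mu (X k))%E).
    apply: le_outer_measure_bigsetU => y [Qy /= fgy].
    have [k ky] := cell_cover N h0 Qy; exists k => //; split => //.
    have Qp := cell_subset h0 (kp k).
    have := le_trans (cube_norm_le ky (kp k)) tr; rewrite le_min => /andP[yp1 yp2].
    split => //; have := gr2 _ _ Qy Qp yp2.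
    have := ler_normD (f y - g (p k)) (g (p k) - g y).
    by rewrite subrKA (distrC (g (p k)) (g y)); lra.
  by rewrite big1// => k _; apply: fr1; exact: cell_subset (kp k).
apply/ae_eq_null; apply/eqP; rewrite eq_le outer_measure_ge0 andbT.
apply: (@le_trans _ _
  (\sum_(m <oo) mu (Q0 `&` [set y | m.+1%:R^-1 <= `|f y - g y|]%R))%E).
  apply: le_trans (outer_measure_sigma_subadditive _ _).
  apply: le_outer_measure => y [Qy /=]; rewrite -subr_eq0 -normr_gt0 => fg0.
  have [m _ /(_ m (leqnn m)) /=] := near_infty_natSinv_lt (PosNum fg0).
  by move=> /ltW me; exists m => //; split.
by rewrite eseries0// => m _ _; apply: fg_e; rewrite invr_gt0.
Qed.

End essential_oscillation.

(** * Vanishing of [Omega] for continuous functions *)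

Section continuous_case.
Variables (R : realType) (n : nat).
Local Notation V := 'rV[R]_n.+1.
Local Notation mu := (@lebesgue_outer R n).
Implicit Types (a b x y : V) (h s e t : R) (f g : V -> R) (Q : set V).

Lemma compact_cube a h : compact (cube a h).
Proof.
rewrite (_ : cube a h = [set v | forall i, `[a 0 i, a 0 i + h]%classic (v ord0 i)]).
  by apply: (rV_compact (A := fun i => `[a 0 i, a 0 i + h]%classic)) => i;
    exact: segment_compact.
by apply/seteqP; split => v av i; have := av i; rewrite /= in_itv.
Qed.

(** The Heine-Cantor theorem, from compactness in its near-covering form with radii tending to 0
    from the right. *)
Lemma uniform_continuity_cube a h g e : {within cube a h, continuous g} -> 0 < e ->
  exists2 r, 0 < r & forall x y, cube a h x -> cube a h y ->
    `|x - y| < r -> `|g x - g y| <= e.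
Proof.
move=> /subspace_continuousP gc e0.
have e20 : 0 < e / 2 by rewrite divr_gt0.
have /compact_near_coveringP/(_ _ (0^'+) (fun r x => cube a h x -> forall y,
    cube a h y -> `|x - y| < r -> `|g x - g y| <= e)) := @compact_cube a h.
case=> [x ax|r /= r0 rP]; last first.
  exists (r / 2); first by rewrite divr_gt0.
  move=> x y ax ay xy; apply: (rP (r / 2)) => //.
    by rewrite /ball_ /= sub0r normrN ger0_norm ?divr_ge0 ?ltW//
      ltr_pdivrMr// ltr_pMr// ltr1n.
  by rewrite divr_gt0.
have /cvgrPdist_le/(_ _ e20)/nbhs_ballP[d /= d0 xd] := gc x ax.
have d20 : 0 < d / 2 by rewrite divr_gt0.
exists (ball x (d / 2), [set r | r <= d / 2]); first split => /=.
- exact: nbhsx_ballx.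
- exists (d / 2) => // r; rewrite /ball_ /= sub0r normrN.
  by move=> /(le_lt_trans (ler_norm _))/ltW.
move=> [z r] /= []; rewrite -ball_normE /= => xz rd az y ay zy.
have := xd z; have := xd y; rewrite -ball_normE /= => gy gz.
have {}gy : `|g x - g y| <= e / 2.
  apply: gy => //; have := ler_normD (x - z) (z - y); rewrite subrKA; lra.
have {}gz : `|g x - g z| <= e / 2 by apply: gz => //; lra.
have := ler_normD (g z - g x) (g x - g y); rewrite subrKA (distrC (g z) (g x)); lra.
Qed.

Lemma Psi_ge0 s g Q1 Q2 : 0 <= s -> (forall x, 0 <= g x) -> 0 <= Psi s g Q1 Q2.
Proof.
move=> s0 g0; apply: addr_ge0; apply: mulr_ge0; rewrite ?max_median_ge0//.
  by rewrite divr_ge0// /volume fine_ge0// outer_measure_ge0.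
by rewrite divr_ge0// /volume fine_ge0// outer_measure_ge0.
Qed.

(** A supremum over no pairs would be minus infinity, so an admissible pair must be exhibited: two
    adjacent cells of a fine subdivision. *)
Lemma Omega_ge0 a h f s (eta : R) : 0 < h -> 0 <= s -> 0 < eta ->
  (0 <= Omega (cube a h) f s eta)%E.
Proof.
move=> h0 s0 eta0.
have r0 : 0 < eta / (n.+1%:R * 2) by rewrite divr_gt0.
have [N0 /(_ (maxn 1 N0) (leq_maxr _ _)) tr] := near_mesh_le h r0.
set N := maxn 1 N0 in tr; have N_gt0 : (0 < N)%N by rewrite leq_maxl.
pose k : {ffun 'I_n.+1 -> 'I_N.+1} := [ffun=> ord0].
have [l lk kl] := cell_adjacent a k h0 N_gt0.
have t0 : 0 < h / N.+1%:R by rewrite divr_gt0.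
apply: (@le_trans _ _ (ereal_inf [set (Psi s (fun x => `|f x - c|)
    (cell a h k) (cell a h l))%:E | c in [set: R]])).
  apply: le_ereal_inf_tmp => _ [c _ <-]; rewrite lee_fin.
  exact: Psi_ge0.
apply: ereal_sup_ubound; exists (cell a h k, cell a h l) => //.
split => /=.
- by split; exact: is_cube_cube.
- by split; exact: cell_subset.
- by apply: cell_nonoverlapping; rewrite eq_sym.
have le2 x y : `|x - y| <= h / N.+1%:R -> `|x - y| <= 2 * (h / N.+1%:R).
  by move=> /le_trans; apply; rewrite ler_pMl// ler1n.
apply: (@le_trans _ _ (n.+1%:R * (2 * (h / N.+1%:R)))).
  apply: diam_le => [|x y [kx|lx] [ky|ly]].
  - by rewrite mulr_ge0 ?ltW.
  - exact/le2/(cube_norm_le kx ky).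
  - exact: kl.
  - by rewrite distrC; exact: kl.
  - exact/le2/(cube_norm_le lx ly).
by rewrite mulrA mulrC -ler_pdivlMr.
Qed.

Lemma weighted_median_le s f g c e a h Q (u : R) : 0 <= s < 1 -> 0 <= e ->
  Q `<=` cube a h -> 0 < h ->
  mu (cube a h `&` [set y | f y != g y]) = 0%E ->
  (forall y, Q y -> `|g y - c| <= e) -> volume Q <= u ->
  volume Q / u * max_median (fun x => `|f x - c|) s Q <= e.
Proof.
move=> /andP[s0 s1] e0 Qa h0 fg ge Qu.
have v0 : 0 <= volume Q by rewrite /volume fine_ge0// outer_measure_ge0.
(* On a null set the strict inequality needed to bound the median fails, but the weight vanishes. *)
have [->|vN0] := eqVneq (volume Q) 0; first by rewrite !mul0r.
have v_gt0 : 0 < volume Q by rewrite lt_neqAle eq_sym vN0.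
have fin := lebesgue_outer_fin_num (ltW h0) Qa.
have m0 : 0 <= max_median (fun x => `|f x - c|) s Q by apply: max_median_ge0.
have vu : volume Q / u <= 1 by rewrite ler_pdivrMr ?mul1r// (lt_le_trans v_gt0).
have vu0 : 0 <= volume Q / u by rewrite divr_ge0// (le_trans v0).
suff : max_median (fun x => `|f x - c|) s Q <= e by nra.
apply: max_median_le => // M eM.
apply: (@lt_le_trans _ _ (mu Q)).
  by rewrite -(fineK fin) -EFinM lte_fin -/(volume Q) gtr_pMl.
rewrite -[leRHS]adde0 -fg.
have le : (mu ((Q `&` [set y | `|f y - c| < M]%R) `|`
    (cube a h `&` [set y | f y != g y])) <= mu (Q `&` [set y | `|f y - c| < M]%R) +
    mu (cube a h `&` [set y | f y != g y]))%E := outer_measureU2 _ _ _.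
apply: le_trans le; apply: le_outer_measure => y Qy.
have [fgy|fgy] := eqVneq (f y) (g y); [left|right]; split => //=.
  by rewrite fgy (le_lt_trans (ge _ Qy)).
exact: Qa.
Qed.

(** The constant is the value of [g] at a point of [Q1]. Each of the two weights is bounded by 1
    separately, whence the factor 2. *)
Lemma Omega_le a h f g s e r (eta : R) : 0 < h -> 0 <= s < 1 -> 0 <= e ->
  mu (cube a h `&` [set y | f y != g y]) = 0%E ->
  (forall x y, cube a h x -> cube a h y -> `|x - y| < r -> `|g x - g y| <= e) ->
  eta < r -> (Omega (cube a h) f s eta <= (2 * e)%:E)%E.
Proof.
move=> h0 s01 e0 fg gr etar; apply: ge_ereal_sup => _ [[Q1 Q2] /= adm <-].
case: adm => /= -[cQ1 cQ2] [Q1a Q2a] _ diamQ.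
have [x Qx] : exists x, Q1 x.
  case: cQ1 => b [t [t0 ->]]; exists b => i /=.
  by rewrite lexx lerDl ltW.
apply: (@le_trans _ _ (Psi s (fun y => `|f y - g x|) Q1 Q2)%:E).
  by apply: ereal_inf_lbound; exists (g x).
have Ua : Q1 `|` Q2 `<=` cube a h by move=> y [/Q1a|/Q2a].
have gx y : (Q1 `|` Q2) y -> `|g y - g x| <= e.
  move=> Qy; apply: gr; [exact: Ua|exact: Q1a|].
  apply: le_lt_trans etar; apply: le_trans diamQ.
  by apply: (norm_le_diam Ua) => //; left.
have finU := lebesgue_outer_fin_num (ltW h0) Ua.
rewrite lee_fin mulr2n mulrDl mul1r; apply: lerD.
  apply: weighted_median_le fg _ _ => // [y Qy|]; first by apply: gx; left.
  apply: fine_le => //; first exact: lebesgue_outer_fin_num (ltW h0) Q1a.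
  by apply: le_outer_measure; left.
apply: weighted_median_le fg _ _ => // [y Qy|]; first by apply: gx; right.
apply: fine_le => //; first exact: lebesgue_outer_fin_num (ltW h0) Q2a.
by apply: le_outer_measure; right.
Qed.

Lemma cvg_Omega a h f s : 0 < h -> 0 <= s < 1 -> equiv_continuous (cube a h) f ->
  Omega (cube a h) f s eta @[eta --> 0^'+] --> 0%E.
Proof.
move=> h0 s01 [g [gc /ae_eq_null fg]].
have bound e : 0 < e -> \forall eta \near 0^'+,
    (0 <= Omega (cube a h) f s eta <= e%:E)%E.
  move=> e0; have e20 : 0 < e / 2 by rewrite divr_gt0.
  have [r r0 gr] := uniform_continuity_cube gc e20.
  near=> eta; apply/andP; split.
    by apply: Omega_ge0 => //; first by case/andP: s01.
  rewrite (_ : e = 2 * (e / 2)); last by rewrite mulrC divfK.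
  by apply: (Omega_le h0 s01 (ltW e20) fg gr).
apply/fine_cvgP; split.
  apply: filterS (bound 1 ltr01) => eta /andP[Oge0 Ole].
  by rewrite ge0_fin_numE// (le_lt_trans Ole)// ltry.
apply/cvgrPdist_le => e /bound; apply: filterS => eta /= /andP[Oge0 Ole].
have fin : Omega (cube a h) f s eta \is a fin_num.
  by rewrite ge0_fin_numE// (le_lt_trans Ole)// ltry.
by rewrite sub0r normrN ger0_norm ?fine_ge0// -lee_fin fineK.
Unshelve. all: by end_near.
Qed.

Lemma cvg_Omega_lt Q f s e : Omega Q f s eta @[eta --> 0^'+] --> 0%E -> 0 < e ->
  exists2 eta, 0 < eta & (Omega Q f s eta < e%:E)%E.
Proof.
move=> /fine_cvgP[finO /cvgrPdist_lt/(_ e) Oe] e0.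
near (0 : R)^'+ => eta; exists eta => //.
have fin : Omega Q f s eta \is a fin_num by near: eta.
rewrite -(fineK fin) lte_fin; apply: le_lt_trans (ler_norm _) _.
rewrite -normrN -sub0r; near: eta; exact: Oe.
Unshelve. all: by end_near.
Qed.

End continuous_case.

(** * Essential bounds and assembly of the two implications *)

Lemma equiv_bounded_le (R : realType) (n : nat) (Q : set 'rV[R]_n.+1)
    (f : 'rV[R]_n.+1 -> R) : equiv_bounded Q f ->
  exists K, lebesgue_outer (Q `&` [set y | K < `|f y|]) = 0%E.
Proof.
move=> [g [[M [_ /(_ (M + 1))]]]] /[!ltrDl] /(_ ltr01) gM /ae_eq_null fg.
exists (M + 1); apply: lebesgue_outer_null_subset fg => y [Qy /= fy]; split => //=.
by apply: contraTneq fy => ->; rewrite -leNgt; exact: gM.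
Qed.

Unset Implicit Arguments.

Theorem theorem3p2 (R : realType) (n : nat) (Q0 : set 'rV[R]_n.+1) (s : R)
    (f : 'rV[R]_n.+1 -> R) :
  is_cube Q0 -> 2^-1 < s < 1 ->
  measurable_fun (Q0 : set (Leb R n)) (f : Leb R n -> R) ->
  equiv_bounded Q0 f ->
  (equiv_continuous Q0 f <-> Omega Q0 f s eta @[eta --> 0^'+] --> 0%E).
Proof.
move=> [a [h [h0 ->]]] s01 mf /equiv_bounded_le[K fK].
rewrite -/(cube a h) in mf fK *.
split=> [|Omega0]; first by apply: cvg_Omega => //; move: s01; lra.
(* This case is vacuous, but ruling it out would require knowing that the measure
   of a cube is its volume, of which only an upper bound is used. *)
have [Q0_eq0|Q0_neq0] := eqVneq (lebesgue_outer (cube a h)) 0%E.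
  exists (cst 0); split.
    by apply: continuous_subspaceT; exact: cst_continuous.
  by apply/ae_eq_null; apply: lebesgue_outer_null_subset Q0_eq0 => y [].
apply: equiv_continuous_osc => // e e0.
(* [small_scale_const] loses a factor 7. *)
have e70 : 0 < e / 7 by rewrite divr_gt0.
have [eta eta0 Oe] := cvg_Omega_lt Omega0 e70.
(* The largest radius allowed by [r_eta]. It does not depend on [x], and this uniformity gives the
   continuity of the representative. *)
have r0 : 0 < eta / (n.+1%:R * 4) by rewrite divr_gt0.
exists (eta / (n.+1%:R * 4)) => // x Qx.
have [|c cP] := small_scale_const h0 s01 mf fK Q0_neq0 e70 Oe r0 _ Qx.
  by rewrite mulrA [leLHS]mulrC divfK// mulf_neq0.
exists c; apply: lebesgue_outer_null_subset cP => y [Qy [yx ye]].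
by split => //; split => //; rewrite mulrC divfK.
Qed.
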